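(* Let $X$ be a normed space, $q>0$, $f:X\to\mathbb R\cup\{+\infty\}$ and $\bar x\in\mathrm{dom}\,f$. Then $$\mathrm{shrp}_q f(\bar x)\le\|f'_q(\bar x;\cdot)\|_q .$$ If $\dim X<+\infty$, then this inequality holds as equality.
   Context: $\mathrm{dom}\,f=\{x\in X: f(x)<+\infty\}$. Sharp minimizer: $\bar x\in\mathrm{dom}\,f$ is a $q$-order sharp minimizer of $f$ with modulus $\tau>0$ if there exists a neighbourhood $U$ of $\bar x$ such that $\tau\|x-\bar x\|^q\le f(x)-f(\bar x)$ for all $x\in U$. The supremum of all such $\tau>0$ is denoted $\mathrm{shrp}_qf(\bar x)\in[0,+\infty]$; it equals $0$ if no such $\tau$ exists. The $q$-order Hadamard directional subderivative of $f$ at $\bar x$ is $f'_q(\bar x;x):=\liminf_{u\to x,\,t\downarrow0}\frac{f(\bar x+tu)-f(\bar x)}{t^q}\in[-\infty,+\infty]$, $x\in X$. Moreover $\|f'_q(\bar x;\cdot)\|_q:=\inf_{x\in X\setminus\{0\}}\frac{(f'_q(\bar x;x))_+}{\|x\|^q}=\inf_{\|x\|=1}(f'_q(\bar x;x))_+$, where $\alpha_+:=\max\{0,\alpha\}$ and $\inf\emptyset=+\infty$. *)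

(* Defs.v *)
From HB Require Import structures.
From mathcomp Require Import all_boot all_order all_algebra.
From mathcomp Require Import all_classical all_reals all_analysis.

Set Implicit Arguments.
Unset Strict Implicit.
Unset Printing Implicit Defensive.

Import Order.TTheory GRing.Theory Num.Theory.
Import numFieldNormedType.Exports.

Local Open Scope classical_set_scope.
Local Open Scope ring_scope.
Local Open Scope ereal_scope.

(* dom f, for f : X -> R \cup {+oo}; such an f is encoded as a map to \bar R
   that never takes the value -oo *)
Definition edom (R : realType) (X : Type) (f : X -> \bar R) : set X :=
  [set x | f x < +oo].

Definition sharp_minimizer (R : realType) (X : normedModType R) (q : R)
    (f : X -> \bar R) (xbar : X) (tau : R) : Prop :=
  [/\ edom f xbar, (0 < tau)%R &
      exists2 U : set X, nbhs xbar U &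
        forall x, U x -> (tau * `|x - xbar| `^ q)%:E <= f x - f xbar].

(* The case distinction is needed because ereal_sup set0 = -oo. *)
Definition shrp (R : realType) (X : normedModType R) (q : R)
    (f : X -> \bar R) (xbar : X) : \bar R :=
  let moduli := [set tau | sharp_minimizer q f xbar tau] in
  if `[< moduli = set0 >] then 0 else ereal_sup (EFin @` moduli).

Definition hadamard_subderivative (R : realType) (X : normedModType R) (q : R)
    (f : X -> \bar R) (xbar x : X) : \bar R :=
  limf_einf (fun ut : X * R => (f (xbar + ut.2 *: ut.1)%R - f xbar)
                                 / (ut.2 `^ q)%:E)
            (filter_prod (nbhs x) (0%R : R)^'+).

Definition subderivative_norm (R : realType) (X : normedModType R) (q : R)
    (h : X -> \bar R) : \bar R :=
  ereal_inf [set h^\+ x / (`|x| `^ q)%:E | x in [set x : X | x != 0%R]].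

(* X is spanned by finitely many vectors *)
Definition finite_dimensional (R : realType) (X : lmodType R) : Prop :=
  exists (n : nat) (e : 'I_n -> X), forall x : X,
    exists c : 'I_n -> R, x = (\sum_(i < n) c i *: e i)%R.

(* Main.v *)
(* A modulus tau bounds the difference quotients below by tau |u|^q near (x, 0),
   hence bounds the subderivative.  Conversely, if the subderivative exceeds tau
   at every unit vector u, then the quotients exceed tau for (u', t) close to
   (u, 0); in finite dimension the unit sphere is compact, so a single range
   0 < t < d works for all directions, and tau is a modulus on the ball of
   radius d.
   The sphere is compact because, for a basis e, the norm of sum_i c_i e_i is
   bounded below on the unit sphere of R^n, so that the coordinates of unit
   vectors of X stay bounded. *)

Require Import Defs.
From mathcomp Require Import all_boot all_order all_algebra.
From mathcomp Require Import all_classical all_reals all_analysis.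
Import numFieldNormedType.Exports.
Import Order.TTheory GRing.Theory Num.Theory.

Local Open Scope classical_set_scope.
Local Open Scope ring_scope.
Local Open Scope ereal_scope.

Lemma limf_einf_gt_near {T : choiceType} {Y : filteredType T} {R : realType}
    {f : Y -> \bar R} {F : set_system Y} {FF : Filter F} {a : \bar R} :
  a < limf_einf f F -> \forall x \near F, a < f x.
Proof.
rewrite limf_einfE => /ereal_sup_gt[_ [V FV <-] aV].
apply: filterS FV => x Vx; apply: (lt_le_trans aV).
by apply: ereal_inf_lbound; exists x.
Qed.

Lemma near_le_limf_einf {T : choiceType} {Y : filteredType T} {R : realType}
    {f : Y -> \bar R} {F : set_system Y} {a : \bar R} :
  (\forall x \near F, a <= f x) -> a <= limf_einf f F.
Proof.
move=> Ff; rewrite limf_einfE; apply: le_trans (ereal_sup_ubound _); last first.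
  by exists [set x | a <= f x].
by apply/ereal_infP => _ [x /= ax <-].
Qed.

(** Induction on the number of spanning vectors: a nontrivial linear relation makes one of them
    redundant, so a shorter family still spans. *)
Lemma independent_spanning_family {R : realType} {X : lmodType R} :
  finite_dimensional X ->
  exists (n : nat) (e : 'I_n -> X),
    (forall x, exists c : 'I_n -> R, x = (\sum_(i < n) c i *: e i)%R) /\
    (forall c : 'I_n -> R,
       (\sum_(i < n) c i *: e i)%R = 0%R -> forall i, c i = 0%R).
Proof.
case=> n [e span]; elim: n e span => [|n IHn] e span.
  by exists 0%N, e; split=> // c _ [].
have [ind|] := pselect (forall c : 'I_n.+1 -> R,
  (\sum_(i < n.+1) c i *: e i)%R = 0%R -> forall i, c i = 0%R).
  by exists n.+1, e.
move=> /existsNP[c /not_implyP[ce0 /existsNP[i /eqP ci0]]].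
apply: (IHn (fun j => e (lift i j))) => x; have [d ->] := span x.
(* Subtracting [d i / c i] times the relation [c] from the expansion [d] of [x] cancels the
   coefficient of [e i]. *)
exists (fun j => d (lift i j) - d i / c i * c (lift i j))%R.
under [RHS]eq_bigr do rewrite scalerBl -scalerA.
rewrite sumrB -scaler_sumr; move: ce0; rewrite (bigD1_ord i)//= addrC.
move=> /eqP; rewrite addr_eq0 => /eqP ->.
by rewrite scalerN opprK scalerA divfK// addrC (bigD1_ord i).
Qed.

Lemma compact_unit_sphere {R : realType} {X : normedModType R} :
  finite_dimensional X -> compact [set x : X | `|x|%R = 1%R].
Proof.
move=> /independent_spanning_family[n [e [span indep]]].
pose phi (c : 'rV[R]_n) : X := (\sum_(i < n) c 0%R i *: e i)%R.
have phic : continuous phi.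
  move=> c; apply: (@cvg_big _ _ _ _ _ _ _ (nbhs c)) => [|i _].
    exact: add_continuous.
  by apply: cvgZr_tmp; exact: coord_continuous.
have phiZ (k : R) c : phi (k *: c)%R = (k *: phi c)%R.
  by rewrite /phi scaler_sumr; apply: eq_bigr => i _; rewrite mxE scalerA.
have phi0 c : c != 0%R -> (0 < `|phi c|)%R.
  rewrite normr_gt0; apply: contra_neq => /indep c0.
  by apply/rowP => i; rewrite mxE c0.
have normphi : continuous (fun c => `|phi c|%R).
  move=> c; apply: continuous_comp; first exact: phic.
  exact: norm_continuous.
have cptS : compact [set c : 'rV[R]_n | `|c|%R = 1%R].
  apply: bounded_closed_compact.
    exists 1%R; split; first exact: num_real.
    by move=> M M1 c /= ->; exact: ltW.
  apply: (@preimage_closed _ _ (@Num.norm R _) (eq^~ 1%R)) => [c _|].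
    exact: norm_continuous.
  exact: closed_eq.
(* Near each [c] of the sphere, every [m] below half of [|phi c|] is a strict lower bound, by
   continuity of [|phi|]; compactness makes one [m] serve all [c]. *)
have [m m0 mS] : exists2 m : R, (0 < m)%R &
    forall c, `|c|%R = 1%R -> (m < `|phi c|)%R.
  move/compact_near_coveringP : cptS.
  move=> /(_ _ (0%R : R)^'+ (fun m c => m < `|phi c|)%R) cov.
  have /filterI/(_ (nbhs_right_gt (0%R:R))) : \forall m \near (0%R : R)^'+,
      [set c : 'rV[R]_n | `|c|%R = 1%R] `<=` (fun c => m < `|phi c|)%R.
    apply: cov => c c1.
    have c0 : (0 < `|phi c| / 2)%R.
      by rewrite divr_gt0// phi0// -normr_gt0 c1.
    exists ([set c' | `|phi c| / 2 < `|phi c'|]%R, [set m | m < `|phi c| / 2]%R).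
      split => /=; last exact: nbhs_right_lt.
      apply: (cvgr_gt _ (normphi c)); rewrite ltr_pdivrMr// mulr_natr.
      by rewrite mulr2n ltrDl phi0// -normr_gt0 c1.
    by case=> c' m /= [h1 h2]; exact: lt_trans h2 h1.
  by move=> /filter_ex[m [h1 h2]]; exists m.
have -> : [set x : X | `|x|%R = 1%R] = phi @` [set c | `|phi c|%R = 1%R].
  apply/seteqP; split => [x /= x1|_ [c c1 <-]//].
  have [c xc] := span x.
  have phix : phi (\row_i c i)%R = x.
    by rewrite [RHS]xc; apply: eq_bigr => i _; rewrite mxE.
  by exists (\row_i c i)%R => //=; rewrite phix.
apply: continuous_compact; first exact: continuous_subspaceT.
apply: bounded_closed_compact; last first.
  apply: (@preimage_closed _ _ (fun c => `|phi c|)%R (eq^~ 1%R)) => [c _|].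
    exact: normphi.
  exact: closed_eq.
(* For [c] nonzero with [|phi c| = 1], homogeneity gives [|phi (c / |c|)| = 1 / |c|], and this
   exceeds [m]. *)
exists m^-1%R; split=> [|M mM c /= c1]; first exact: num_real.
apply: le_trans (ltW mM).
have [->|c0] := eqVneq c 0%R; first by rewrite normr0 invr_ge0 ltW.
have := mS (`|c|^-1 *: c)%R; rewrite phiZ !normrZ c1 normfV normr_id mulr1.
rewrite mulVf ?normr_eq0// => /(_ erefl)/ltW mc.
by rewrite -[leLHS]invrK lef_pV2// posrE ?invr_gt0// normr_gt0.
Qed.

Lemma edivE {R : realType} (x : \bar R) (r : R) :
  (0 < r)%R -> x / r%:E = x * (r^-1)%:E.
Proof. by move=> r0; rewrite inver gt_eqF. Qed.

(** At [(u, t)] the quotient is bounded below by [tau * |u| ^ q], not by [tau * |x| ^ q]; the slack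
    [e] absorbs the difference as [u] tends to [x]. *)
Lemma sharp_minimizer_le_subderivative {R : realType} {X : normedModType R}
    {q : R} {f : X -> \bar R} {xbar : X} {tau : R} {x : X} :
  sharp_minimizer q f xbar tau -> x != 0%R ->
  (tau * `|x| `^ q)%:E <= hadamard_subderivative q f xbar x.
Proof.
move=> [fxbar tau0 [U Ux fU]] x0; apply/lee_subgt0Pr => e e0.
apply: near_le_limf_einf.
have xp : (0 < `|x|)%R by rewrite normr_gt0.
have powc : (tau * `|u| `^ q)%R @[u --> x] --> (tau * `|x| `^ q)%R.
  apply: cvgM; first exact: cvg_cst.
  apply: (@continuous_comp _ _ _ (@Num.norm R X) (fun r => r `^ q)%R).
    exact: norm_continuous.
  apply/differentiable_continuous/derivable1_diffP/derivable_powR.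
  by rewrite in_itv/= xp.
(* The point [xbar + t u] tends to [xbar], since [t] tends to 0 while [u] tends to [x]. *)
have Uxt : \forall ut \near filter_prod (nbhs x) (0%R : R)^'+,
    U (xbar + ut.2 *: ut.1)%R.
  have : (xbar + ut.2 *: ut.1)%R @[ut --> filter_prod (nbhs x) (0%R : R)^'+] --> xbar.
    rewrite -[X in _ --> X]addr0 -(scale0r x).
    apply: cvgD; first exact: cvg_cst.
    apply: cvgZ; last exact: cvg_fst.
    by apply: cvg_trans; [exact: cvg_snd|exact: cvg_within].
  exact.
have tpos : \forall ut \near filter_prod (nbhs x) (0%R : R)^'+, (0 < ut.2)%R.
  exact: (@cvg_snd _ _ (nbhs x) _ _ _ (nbhs_right_gt (0%R : R))).
have powe : \forall ut \near filter_prod (nbhs x) (0%R : R)^'+,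
    (tau * `|x| `^ q - e < tau * `|ut.1| `^ q)%R.
  have powx : \forall u \near x, (tau * `|x| `^ q - e < tau * `|u| `^ q)%R.
    by apply: (cvgr_gt _ powc); rewrite ltrBlDr ltrDl.
  exact: (@cvg_fst _ _ _ _ _ _ powx).
near=> ut.
have t0 : (0 < ut.2)%R by near: ut.
have tq0 : (0 < ut.2 `^ q)%R by rewrite powR_gt0.
rewrite edivE// lee_pdivlMr//.
have : U (xbar + ut.2 *: ut.1)%R by near: ut.
move=> /fU; apply: le_trans.
rewrite [(_ + _ *: _ - _)%R]addrAC subrr add0r normrZ gtr0_norm//.
rewrite powRM// ?(ltW t0)// -EFinB -EFinM lee_fin mulrCA mulrC ler_pM2l//.
by rewrite ltW//; near: ut.
Unshelve. all: by end_near. Qed.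

Lemma subderivative_gt_sharp_minimizer {R : realType} {X : normedModType R}
    {q : R} {f : X -> \bar R} {xbar : X} {tau : R} :
  f xbar \is a fin_num -> (0 < tau)%R -> (0 < q)%R ->
  compact [set u : X | `|u|%R = 1%R] ->
  (forall u, `|u|%R = 1%R -> tau%:E < hadamard_subderivative q f xbar u) ->
  sharp_minimizer q f xbar tau.
Proof.
move=> fxbar tau0 q0 /compact_near_coveringP cptS tauh.
(* The lower limit is joint in direction and step, so it gives exactly the local condition, in [u]
   and [t] together, that the covering form of compactness requires. *)
have [d /= d0 dS] : \forall t \near (0%R : R)^'+,
    [set u : X | `|u|%R = 1%R] `<=`
    (fun u => tau%:E < (f (xbar + t *: u)%R - f xbar) / (t `^ q)%:E).
  apply: cptS => u u1.
  have := limf_einf_gt_near (tauh _ u1).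
  exact.
split=> //; first by rewrite /edom/= ltey_eq fxbar.
exists (ball xbar d); first exact: nbhsx_ballx.
(* The centre has no direction and is treated apart; there [q > 0] matters, as [0 ^ q = 0] whereas
   [0 ^ 0 = 1]. *)
move=> x xd; have [->|xxbar] := eqVneq x xbar.
  by rewrite subrr normr0 powR0 ?gt_eqF// mulr0 subee.
have t0 : (0 < `|x - xbar|)%R by rewrite normr_gt0 subr_eq0.
(* Polar decomposition: the step is [t = |x - xbar|] and the direction is [(x - xbar) / t], so that
   [xbar + t u = x]. *)
have := dS `|x - xbar|%R _ _ (`|x - xbar|^-1 *: (x - xbar))%R.
rewrite /= normrZ normfV normr_id mulVf ?gt_eqF// => /(_ _ t0 erefl).
rewrite scalerA divff ?gt_eqF// scale1r (addrC xbar) subrK edivE ?powR_gt0//.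
rewrite lte_pdivlMr ?powR_gt0// => h; rewrite EFinM; apply/ltW/h.
by move: xd; rewrite -ball_normE/= distrC sub0r normrN normr_id.
Qed.

Theorem proposition3p14 (R : realType) (X : normedModType R) (q : R)
    (hq : (0 < q)%R) (f : X -> \bar R) (hf : forall x : X, f x != -oo)
    (xbar : X) (hxbar : edom f xbar) :
  shrp q f xbar <= subderivative_norm q (hadamard_subderivative q f xbar) /\
  (finite_dimensional X ->
   shrp q f xbar = subderivative_norm q (hadamard_subderivative q f xbar)).
Proof.
have fxbar : f xbar \is a fin_num by rewrite fin_numE hf lt_eqF.
have norm_ge0 : 0 <= subderivative_norm q (hadamard_subderivative q f xbar).
  apply/ereal_infP => _ [x /= x0 <-].
  rewrite edivE ?powR_gt0 ?normr_gt0// lee_pdivlMr ?powR_gt0 ?normr_gt0//.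
  by rewrite mul0e funepos_ge0.
have shrp_le :
    shrp q f xbar <= subderivative_norm q (hadamard_subderivative q f xbar).
  (* Without any modulus [shrp] is 0, and [norm_ge0] concludes. *)
  rewrite /shrp; case: asboolP => // _.
  apply: ge_ereal_sup => _ [tau tau_sharp <-].
  apply/ereal_infP => _ [x /= x0 <-].
  rewrite edivE ?powR_gt0 ?normr_gt0// lee_pdivlMr ?powR_gt0 ?normr_gt0//.
  by rewrite -EFinM funeposE le_max sharp_minimizer_le_subderivative.
split=> // /compact_unit_sphere cptS; apply/eqP; rewrite eq_le shrp_le/=.
have shrp_ub (tau : R) : sharp_minimizer q f xbar tau -> tau%:E <= shrp q f xbar.
  move=> tau_sharp; rewrite /shrp.
  case: asboolP => [/seteqP[/(_ _ tau_sharp)]//|_].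
  by apply: ereal_sup_ubound; exists tau.
have shrp_ge0 : 0 <= shrp q f xbar.
  rewrite /shrp; case: asboolP => // /eqP/set0P[tau tau_sharp].
  apply: (@le_trans _ _ tau%:E); last by apply: ereal_sup_ubound; exists tau.
  by rewrite lee_fin; case: tau_sharp => _ /ltW.
rewrite leNgt; apply/negP => lt_norm.
(* A real number strictly inside the supposed gap: the midpoint, or [r + 1] if the norm is infinite.
   It will turn out to be a modulus above the supremum of the moduli. *)
have [tau shrp_tau tau_norm] : exists2 tau : R, shrp q f xbar < tau%:E &
    tau%:E < subderivative_norm q (hadamard_subderivative q f xbar).
  move: shrp_ge0 lt_norm; case: (shrp q f xbar) => [r||]//; last first.
    by move=> _; rewrite ltNge leey.
  case: (subderivative_norm _ _) => [N||]// _ rN.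
    by exists ((r + N) / 2)%R; rewrite lte_fin ?midf_lt.
  by exists (r + 1)%R; rewrite ?ltry// lte_fin ltrDl.
have tau0 : (0 < tau)%R by rewrite -lte_fin (le_lt_trans shrp_ge0).
have := shrp_tau; rewrite ltNge => /negP; apply; apply: shrp_ub.
apply: subderivative_gt_sharp_minimizer => // u u1.
have u0 : u != 0%R by rewrite -normr_gt0 u1.
have : subderivative_norm q (hadamard_subderivative q f xbar) <=
    (hadamard_subderivative q f xbar)^\+ u.
  apply: ereal_inf_lbound; exists u => //=.
  by rewrite u1 powR1 edivE// invr1 mule1.
move=> /(lt_le_trans tau_norm).
by rewrite funeposE lt_max lte_fin (lt_gtF tau0) orbF.
Qed.
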